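(* Let $\Bbbk\subset\mathbb K$ be fields, and let $\mathrm{ZR}(\mathbb K/\Bbbk)^{\Bbbk}$ be the set of valuations in $\mathrm{ZR}(\mathbb K/\Bbbk)$ whose residue field is $\Bbbk$. Then the Zariski topology and the Weak Inverse topology coincide on $\mathrm{ZR}(\mathbb K/\Bbbk)^{\Bbbk}$. If $\Bbbk$ is a finite field, the Zariski topology and the Inverse topology coincide on $\mathrm{ZR}(\mathbb K/\Bbbk)^{\Bbbk}$.
   Context: $\mathrm{ZR}(\mathbb K/\Bbbk)$ is the set of valuations $\nu:\mathbb K\to\Gamma_\nu\cup\{\infty\}$ on $\mathbb K$ (with $\Gamma_\nu$ a totally ordered abelian group) that are trivial on $\Bbbk$ ($\nu(a)=0$ for $a\in\Bbbk\setminus\{0\}$), two valuations being identified when they have the same valuation ring. The residue field of $\nu$ is $\Bbbk$ when the natural map from $\Bbbk$ to the residue field $V_\nu/\mathfrak m_\nu$ is an isomorphism, where $V_\nu$ is the valuation ring and $\mathfrak m_\nu$ its maximal ideal. For $x\in\mathbb K$ let $\mathcal O(x)=\{\nu\mid\nu(x)\geq0\}$, $\mathcal U(x)=\{\nu\mid\nu(x)>0\}$ and $\mathcal V(x)=\{\nu\mid\exists a\in\Bbbk,\ \nu(x+a)>0\}$. The Zariski (resp. Inverse, resp. Weak Inverse) topology on $\mathrm{ZR}(\mathbb K/\Bbbk)$ is the topology generated by the $\mathcal O(x)$ (resp. $\mathcal U(x)$, resp. $\mathcal V(x)$), $x\in\mathbb K$; subsets carry the induced topologies. *)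

(* Defs.v *)
From HB Require Import structures.
From mathcomp Require Import all_boot all_order all_algebra.
From mathcomp Require Import ring_quotient.
From mathcomp Require Import all_classical topology.

Set Implicit Arguments.
Unset Strict Implicit.
Unset Printing Implicit Defensive.

Import Order.TTheory GRing.Theory.
Local Open Scope classical_set_scope.
Local Open Scope ring_scope.

(** Totally ordered abelian groups; [porderZmodType] by itself requires no
    compatibility between the order and the addition. *)
Record orderedAbGroup := OrderedAbGroup {
  oag_sort :> porderZmodType;
  oag_total : total (<=%R : rel oag_sort);
  oag_leD2l : forall z x y : oag_sort, x <= y -> z + x <= z + y
}.

(** [option G] is [G] with a largest, absorbing element [None] = infinity. *)
Section Infinity.
Variable G : orderedAbGroup.

Definition lei (u v : option G) : bool :=
  match u, v with
  | _, None => true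
  | None, Some _ => false
  | Some a, Some b => a <= b
  end.

Definition lti (u v : option G) : bool :=
  match u, v with
  | None, _ => false
  | Some _, None => true
  | Some a, Some b => a < b
  end.

Definition addi (u v : option G) : option G :=
  match u, v with
  | Some a, Some b => Some (a + b)
  | _, _ => None
  end.

Definition mini (u v : option G) : option G := if lei u v then u else v.

End Infinity.

Section Valuations.
Variables (k K : fieldType) (iota : {rmorphism k -> K}).

Record valuation := Valuation {
  value_group : orderedAbGroup;
  nu_fun :> K -> option value_group;
  nu_infty : forall x, nu_fun x = None <-> x = 0;
  nuM : forall x y, nu_fun (x * y) = addi (nu_fun x) (nu_fun y);
  nuD : forall x y, lei (mini (nu_fun x) (nu_fun y)) (nu_fun (x + y));
  nu_triv : forall a : k, a != 0 -> nu_fun (iota a) = Some 0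
}.

Definition nu_ge0 (nu : valuation) (x : K) : bool := lei (Some 0) (nu x).
Definition nu_gt0 (nu : valuation) (x : K) : bool := lti (Some 0) (nu x).

End Valuations.

Section ValuationRing.
Variables (k K : fieldType) (iota : {rmorphism k -> K}) (nu : valuation iota).

Let G := value_group nu.

Let leDG (a b c d : G) : a <= b -> c <= d -> a + c <= b + d.
Proof.
move=> ab cd; apply: (@le_trans _ _ (b + c)); last exact: oag_leD2l.
by rewrite ![_ + c]addrC; exact: oag_leD2l.
Qed.

Let lei_trans : transitive (@lei G).
Proof. by case=> [b|] [a|] [c|] //=; exact: le_trans. Qed.

Let nu0 : nu 0 = None. Proof. exact/nu_infty. Qed.

Let nu1 : nu 1 = Some 0.
Proof. by rewrite -(rmorph1 iota) (nu_triv nu) // oner_eq0. Qed.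

Let nuN1 : nu (-1) = Some 0.
Proof. by rewrite -(rmorphN1 iota) (nu_triv nu) // oppr_eq0 oner_eq0. Qed.

Let nuN x : nu (- x) = nu x.
Proof.
rewrite -mulN1r nuM nuN1; case: (nu x) => //= a.
by rewrite add0r.
Qed.

Let min_ge (u v w : option G) : lei u v -> lei u w -> lei u (mini v w).
Proof. by rewrite /mini; case: ifP. Qed.

Let min_gt (u v w : option G) : lti u v -> lti u w -> lti u (mini v w).
Proof. by rewrite /mini; case: ifP. Qed.

Let lti_lei_trans (u v w : option G) : lti u v -> lei v w -> lti u w.
Proof. by case: u v w => [a|] [b|] [c|] //=; exact: lt_le_trans. Qed.

Let nu_ge0P : subring_closed (nu_ge0 nu).
Proof.
split=> [|x y x0 y0|x y]; rewrite ?unfold_in /nu_ge0.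
- by rewrite nu1 /=.
- by apply: lei_trans (nuD nu _ _); rewrite nuN; exact: min_ge.
- rewrite nuM; case: (nu x) (nu y) => [a|] [b|] //=.
  by move=> a0 b0; rewrite -[0]addr0; exact: leDG.
Qed.

HB.instance Definition _ := GRing.isSubringClosed.Build K (nu_ge0 nu) nu_ge0P.

Definition valuation_ring : Type := {x : K | x \in nu_ge0 nu}.

HB.instance Definition _ := [isSub of valuation_ring for @sval K _].
HB.instance Definition _ := [Choice of valuation_ring by <:].
HB.instance Definition _ := [SubChoice_isSubComNzRing of valuation_ring by <:].

Definition max_ideal (x : valuation_ring) : bool := nu_gt0 nu (val x).

Let max_idealP : idealr_closed max_ideal.
Proof.
split=> [||a x y].
- by rewrite unfold_in /max_ideal rmorph0 /nu_gt0 nu0.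
- by rewrite unfold_in /max_ideal rmorph1 /nu_gt0 nu1 /= ltxx.
rewrite !unfold_in /max_ideal rmorphD rmorphM /= => x0 y0.
apply: lti_lei_trans (nuD nu _ _); apply: min_gt => //.
rewrite nuM; have := valP a; rewrite unfold_in /nu_ge0 /=.
move: x0; rewrite /nu_gt0; case: (nu (\val x)) (nu (\val a)) => [u|] [v|] //=.
move=> u0 v0; apply: lt_le_trans u0 _.
by rewrite -[leLHS]add0r; exact: leDG.
Qed.

HB.instance Definition _ := isIdealr.Build valuation_ring max_ideal max_idealP.

Definition residue_field : Type :=
  {ideal_quot (max_ideal : idealr valuation_ring)}.

HB.instance Definition _ := NzRingQuotient.on residue_field.
HB.instance Definition _ := GRing.ComNzRing.on residue_field.

Let iota_ge0 (a : k) : iota a \in nu_ge0 nu.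
Proof.
rewrite unfold_in /nu_ge0; have [->|a0] := eqVneq a 0.
  by rewrite rmorph0 nu0.
by rewrite nu_triv /=.
Qed.

Definition base_to_valuation_ring (a : k) : valuation_ring :=
  exist _ (iota a) (iota_ge0 a).

Let base_to_valuation_ring_zmod : zmod_morphism base_to_valuation_ring.
Proof. by move=> a b; apply: val_inj; rewrite /= rmorphB. Qed.

Let base_to_valuation_ring_monoid : monoid_morphism base_to_valuation_ring.
Proof.
split=> [|a b]; apply: val_inj; first by rewrite /= rmorph1.
by rewrite /= rmorphM.
Qed.

HB.instance Definition _ := GRing.isZmodMorphism.Build k valuation_ring
  base_to_valuation_ring base_to_valuation_ring_zmod.
HB.instance Definition _ := GRing.isMonoidMorphism.Build k valuation_ring
  base_to_valuation_ring base_to_valuation_ring_monoid.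

Definition base_to_residue_field : {rmorphism k -> residue_field} :=
  (\pi_(residue_field)%qT \o base_to_valuation_ring).

Definition residue_field_is_base : Prop := bijective base_to_residue_field.

End ValuationRing.

(** [ZR iota] is the quotient of the collection of valuations by "same
    valuation ring", realised as the set of all valuation rings: a class is
    encoded by the common valuation ring of its members. The value groups range
    over a whole universe, so a quotient type of [valuation iota] itself would
    not fit in the universe of choice types. *)
Section ZariskiRiemann.
Variables (k K : fieldType) (iota : {rmorphism k -> K}).

Definition ZR : Type :=
  set_type [set V : set K |
    exists nu : valuation iota, V = [set x | nu_ge0 nu x]].

HB.instance Definition _ := Choice.on ZR.

Definition class_of (nu : valuation iota) : ZR :=
  exist _ [set x | nu_ge0 nu x] (mem_set (ex_intro _ nu erefl)).

Definition classes (P : valuation iota -> Prop) : set ZR :=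
  [set c | exists2 nu, class_of nu = c & P nu].

Definition ZO (x : K) : set ZR := classes (fun nu => nu_ge0 nu x).

Definition ZU (x : K) : set ZR := classes (fun nu => nu_gt0 nu x).

Definition ZV (x : K) : set ZR :=
  classes (fun nu => exists a : k, nu_gt0 nu (x + iota a)).

Definition ZRk : set ZR := classes (@residue_field_is_base k K iota).

Lemma class_of_eq (nu mu : valuation iota) :
  class_of nu = class_of mu <-> (forall x, nu_ge0 nu x = nu_ge0 mu x).
Proof.
split=> [/(congr1 sval) /= E x|E]; last first.
  by apply: val_inj; apply/funext => x /=; rewrite E.
by apply/idP/idP => h; [rewrite -[is_true _]/([set x | nu_ge0 mu x] x) -E
  | rewrite -[is_true _]/([set x | nu_ge0 nu x] x) E].
Qed.

Lemma class_of_surj (c : ZR) : exists nu : valuation iota, class_of nu = c.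
Proof.
case: c => V hV; have [nu Vnu] := set_mem hV.
by exists nu; apply: val_inj.
Qed.

End ZariskiRiemann.

Arguments ZO {k K} iota x.
Arguments ZU {k K} iota x.
Arguments ZV {k K} iota x.
Arguments ZRk {k K} iota.

Definition generated_topology (T : choiceType) (B : set (set T)) : Type := T.

Section GeneratedTopology.
Variables (T : choiceType) (B : set (set T)).
HB.instance Definition _ := Choice.copy (generated_topology B) T.
HB.instance Definition _ :=
  @isSubBaseTopological.Build (generated_topology B)
    (set T) B id.
End GeneratedTopology.

Section Topologies.
Variables (k K : fieldType) (iota : {rmorphism k -> K}).

Definition zariski_space : topologicalType := generated_topology (range (ZO iota)).
Definition inverse_space : topologicalType := generated_topology (range (ZU iota)).
Definition weak_inverse_space : topologicalType :=
  generated_topology (range (ZV iota)).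

(** Open sets of the subspace [ZRk] for the three topologies ([set_type A]
    carries the topology induced by the ambient space). *)
Definition zariski_open : set (set (ZRk iota)) :=
  @open (set_type (ZRk iota : set zariski_space)).
Definition inverse_open : set (set (ZRk iota)) :=
  @open (set_type (ZRk iota : set inverse_space)).
Definition weak_inverse_open : set (set (ZRk iota)) :=
  @open (set_type (ZRk iota : set weak_inverse_space)).

End Topologies.

Arguments zariski_open {k K} iota.
Arguments inverse_open {k K} iota.
Arguments weak_inverse_open {k K} iota.

(* Main.v *)
Require Import Defs.
From mathcomp Require Import all_boot all_order all_algebra.
From mathcomp Require Import ring_quotient.
From mathcomp Require Import all_classical topology.

Set Implicit Arguments.
Unset Strict Implicit.
Unset Printing Implicit Defensive.

Import Order.TTheory GRing.Theory.

(** The value group of a valuation is totally ordered, so [nu x > 0] holds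
exactly when [x = 0] or [nu x^-1 >= 0] fails ([nu_gt0E]). In particular the
sign of [nu x] depends only on the valuation ring, and membership of a class in
[ZO x], [ZU x] or [ZV x] can be tested on any representative.

Suppose that the residue field of [nu] is [k]. If [nu x >= 0], the residue of
[x] is that of some constant [b], so that [nu (x - b) > 0]; conversely
[nu (x + a) > 0] gives [nu x >= 0] because [nu a >= 0]. Hence [ZO x] and [ZV x]
have the same trace on [ZRk] ([ZO_ZV_trace]), which is the first equality of
topologies: by [generated_trace_sub], induced topologies may be compared on
generators.

For the second one, [ZV x] is the union of the [ZU (x + a)], so every weak
inverse open set is inverse open. Conversely, the constant [a] with
[nu (x + a) > 0] is unique, so on [ZRk] the condition [nu x > 0] says that
[nu x >= 0] and that no nonzero [a] satisfies [nu (x + a) > 0] ([ZU_trace]).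
The failure of [nu y > 0] means [y != 0] and [nu y^-1 >= 0], a Zariski open
condition, and when [k] is finite only finitely many such conditions are
intersected. *)

Local Open Scope classical_set_scope.
Local Open Scope ring_scope.

Lemma open_bigcap_finite (X : topologicalType) (I : choiceType) (D : set I)
    (F : I -> set X) :
  finite_set D -> (forall i, D i -> open (F i)) -> open (\bigcap_(i in D) F i).
Proof.
move=> finD oF; rewrite -bigsetI_fset_set // big_seq.
elim/big_ind: _ => [|A B|i]; [exact: openT|exact: openI|].
by rewrite in_fset_set // inE; exact: oF.
Qed.

(** A map into a generated topology is continuous once the preimages of the
generators are open: preimages commute with the finite intersections and the
unions that produce all open sets. *)
Lemma open_preimage_generated (X : topologicalType) (T : choiceType)
    (B : set (set T)) (f : X -> T) :
  (forall A, B A -> open (f @^-1` A)) ->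
  forall V : set (generated_topology B), open V -> open (f @^-1` V).
Proof.
move=> oB V [D' sD' <-]; rewrite preimage_bigcup; apply: bigcup_open => A.
move=> /sD' [E sE <-]; rewrite preimage_bigcap; apply: open_bigcap_finite.
  exact: finite_fset.
by move=> C CE; apply: oB; exact/set_mem/sE.
Qed.

Lemma generated_trace_sub (T : choiceType) (B1 B2 : set (set T)) (A : set T) :
  (forall C, B1 C ->
    @open (set_type (A : set (generated_topology B2))) (set_val @^-1` C)) ->
  @open (set_type (A : set (generated_topology B1))) `<=`
  @open (set_type (A : set (generated_topology B2))).
Proof. by move=> oB _ [V oV <-]; exact: open_preimage_generated oV. Qed.

Lemma open_trace_generator (T : choiceType) (B : set (set T)) (A C : set T) :
  B C -> @open (set_type (A : set (generated_topology B))) (set_val @^-1` C).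
Proof.
move=> BC; exists C => //; exists [set C]; last exact: bigcup_set1.
by move=> _ ->; exact: finI_from1.
Qed.

Section Valuation.
Variables (k K : fieldType) (iota : {rmorphism k -> K}).
Implicit Types (nu mu : valuation iota) (x y : K) (a : k).

(** Positivity is thereby expressed through the valuation ring alone. Since
[0^-1 = 0], the case [x = 0] has to be a separate disjunct. *)
Lemma nu_gt0E nu x : nu_gt0 nu x = (x == 0) || ~~ nu_ge0 nu x^-1.
Proof.
have [->|x0] := eqVneq x 0.
  by rewrite /nu_gt0; have /nu_infty -> : 0 = 0 :> K.
rewrite /nu_gt0 /nu_ge0 /=.
have := nuM nu x x^-1; rewrite divff // -(rmorph1 iota) nu_triv ?oner_eq0 //.
case: (nu x) (nu x^-1) => [g|] [h|] //= [gh0].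
have leD := @oag_leD2l (value_group nu).
have -> : h = - g by apply/eqP; rewrite -addr_eq0 addrC -gh0.
rewrite lt_neqAle; apply/andP/idP => [[g0 leg]|nleg]; last first.
  have leg : 0 <= g.
    have /orP[//|/(leD (- g))] := oag_total 0 g.
    by rewrite addNr addr0 (negPf nleg).
  by split=> //; apply: contraNN nleg => /eqP <-; rewrite oppr0.
apply: contraNN g0 => /(leD g); rewrite addr0 subrr => leg'.
by rewrite eq_le leg leg'.
Qed.

Lemma class_of_gt0 nu mu x :
  class_of nu = class_of mu -> nu_gt0 nu x = nu_gt0 mu x.
Proof. by move=> /class_of_eq E; rewrite !nu_gt0E E. Qed.

Lemma ZO_class nu x : ZO iota x (class_of nu) <-> nu_ge0 nu x.
Proof.
by split=> [[mu /class_of_eq E]|nx]; [rewrite E|exists nu].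
Qed.

Lemma ZU_class nu x : ZU iota x (class_of nu) <-> nu_gt0 nu x.
Proof.
by split=> [[mu /class_of_gt0 E]|nx]; [rewrite E|exists nu].
Qed.

Lemma ZV_class nu x :
  ZV iota x (class_of nu) <-> exists a, nu_gt0 nu (x + iota a).
Proof.
split=> [[mu /class_of_gt0 E [a]]|nx]; last by exists nu.
by rewrite E; exists a.
Qed.

Lemma ZV_bigcup x : ZV iota x = \bigcup_a ZU iota (x + iota a).
Proof.
apply/seteqP; split=> c; have [nu <-] := class_of_surj c.
  by move=> /ZV_class[a] /ZU_class; exists a.
by move=> [a _ /ZU_class nua]; apply/ZV_class; exists a.
Qed.

Lemma nu_ge0_iota nu a : nu_ge0 nu (iota a).
Proof. exact: (valP (base_to_valuation_ring nu a)). Qed.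

Lemma nu_gt0_ge0 nu x : nu_gt0 nu x -> nu_ge0 nu x.
Proof. by rewrite /nu_gt0 /nu_ge0; case: (nu x) => //= g /ltW. Qed.

Lemma nu_gt0_iota nu a : nu_gt0 nu (iota a) = (a == 0).
Proof. by rewrite nu_gt0E -fmorphV nu_ge0_iota orbF fmorph_eq0. Qed.

(** The set where [nu] is positive is a subgroup, being the image in [K] of the
ideal [max_ideal]. *)
Lemma nu_gt0B nu x y : nu_gt0 nu x -> nu_gt0 nu y -> nu_gt0 nu (x - y).
Proof.
move=> x0 y0.
(* Moving to the valuation ring makes [max_ideal] available as an ideal. *)
pose vx : valuation_ring nu := exist _ x (nu_gt0_ge0 x0).
pose vy : valuation_ring nu := exist _ y (nu_gt0_ge0 y0).
exact: (@rpredB _ (max_ideal (nu := nu) : idealr _) vx vy).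
Qed.

Lemma nu_gt0_shift_ge0 nu x a : nu_gt0 nu (x + iota a) -> nu_ge0 nu x.
Proof.
move=> /nu_gt0_ge0 nxa; rewrite -(addrK (iota a) x).
pose v : valuation_ring nu := exist _ (x + iota a) nxa.
exact: (valP (v - base_to_valuation_ring nu a)).
Qed.

(** The residue of [x] is that of some constant; because of the sign in
[x + iota a], the witness is the opposite of this constant. *)
Lemma residue_field_lift nu x : residue_field_is_base nu ->
  nu_ge0 nu x -> exists a, nu_gt0 nu (x + iota a).
Proof.
move=> [g _ gK] nx; pose v : valuation_ring nu := exist _ x nx.
pose r : residue_field nu := (\pi_(residue_field nu) v)%qT.
exists (- g r); have /eqP := esym (gK r).
rewrite -[_ == _]/(v == base_to_valuation_ring nu (g r)
                     %[mod residue_field nu])%qT.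
by rewrite -Quotient.idealrBE rmorphN.
Qed.

Lemma ZRk_class (c : ZR iota) : ZRk iota c ->
  exists2 nu, c = class_of nu & residue_field_is_base nu.
Proof. by case=> nu <-; exists nu. Qed.

Lemma ZO_ZV_trace (c : ZR iota) x : ZRk iota c -> ZO iota x c <-> ZV iota x c.
Proof.
move=> /ZRk_class[nu -> resk]; rewrite ZO_class ZV_class.
by split=> [/residue_field_lift|[a /nu_gt0_shift_ge0]]; [apply|].
Qed.

(** If [nu x > 0] and [nu (x + a) > 0], the constant [a] has positive value and
is therefore zero; conversely, when [nu x >= 0] some [a] has
[nu (x + a) > 0], and excluding the nonzero ones leaves [a = 0]. *)
Lemma ZU_trace (c : ZR iota) x : ZRk iota c ->
  ZU iota x c <->
  ZO iota x c /\ forall a, a != 0 -> ~ ZU iota (x + iota a) c.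
Proof.
move=> /ZRk_class[nu -> resk]; rewrite ZU_class ZO_class; split=> [x0|[nx xa]].
  split=> [|a a0 /ZU_class xa]; first exact: nu_gt0_ge0.
  have := nu_gt0B xa x0; rewrite addrC addKr nu_gt0_iota.
  by rewrite (negPf a0).
have [a] := residue_field_lift resk nx; have [->|a0] := eqVneq a 0.
  by rewrite rmorph0 addr0.
by move=> /ZU_class/(xa a a0).
Qed.

(** The complement of [ZU x] is [ZO x^-1], except for [x = 0] where it is
empty. *)
Lemma zariski_open_not_ZU x :
  zariski_open iota [set c | ~ ZU iota x (set_val c)].
Proof.
have [->|x0] := eqVneq x 0.
  have -> : [set c : ZRk iota | ~ ZU iota 0 (set_val c)] = set0.
    apply/seteqP; split=> // c /=; have [nu <-] := class_of_surj (set_val c).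
    by case; apply/ZU_class; rewrite nu_gt0E eqxx.
  exact: open0.
have -> : [set c : ZRk iota | ~ ZU iota x (set_val c)] =
          set_val @^-1` (ZO iota x^-1).
  apply/predeqP => c /=; have [nu <-] := class_of_surj (set_val c).
  rewrite ZU_class ZO_class nu_gt0E (negPf x0) /=.
  by split=> [/negP|->]; rewrite ?negbK.
by apply: open_trace_generator; exists x^-1.
Qed.

End Valuation.

Theorem proposition4p18 (k K : fieldType) (iota : {rmorphism k -> K}) :
  zariski_open iota = weak_inverse_open iota /\
  (finite_set [set: k] -> zariski_open iota = inverse_open iota).
Proof.
have traceOV x :
    set_val @^-1` ZO iota x = set_val @^-1` ZV iota x :> set (ZRk iota).
  by apply/seteqP; split=> c /= /ZO_ZV_trace; apply; exact: set_valP.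
have zariski_weak : zariski_open iota `<=` weak_inverse_open iota.
  apply: generated_trace_sub => _ [x _ <-]; rewrite traceOV.
  by apply: open_trace_generator; exists x.
have weak_zariski : weak_inverse_open iota `<=` zariski_open iota.
  apply: generated_trace_sub => _ [x _ <-]; rewrite -traceOV.
  by apply: open_trace_generator; exists x.
split=> [|fink]; apply/seteqP; split=> //.
  apply: subset_trans zariski_weak _.
  apply: generated_trace_sub => _ [x _ <-].
  rewrite ZV_bigcup preimage_bigcup; apply: bigcup_open => a _.
  by apply: open_trace_generator; exists (x + iota a).
apply: generated_trace_sub => _ [x _ <-].
have -> : set_val @^-1` ZU iota x =
    set_val @^-1` ZO iota x `&` \bigcap_(a in [set a : k | a != 0])
      [set c : ZRk iota | ~ ZU iota (x + iota a) (set_val c)].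
  apply/seteqP; split=> c /=; have ck : ZRk iota (set_val c) by exact: set_valP.
    by move=> /ZU_trace -/(_ ck)[].
  by move=> [xc xac]; apply/(ZU_trace x ck).
apply: openI; first by apply: open_trace_generator; exists x.
apply: open_bigcap_finite => [|a _]; last exact: zariski_open_not_ZU.
exact: sub_finite_set fink.
Qed.
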